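(* Let $j$ and $m$ be integers and $n$ a non-negative integer. Then \[ \sum_{k=0}^n(-1)^k\binom{n}{k}\frac{F_{jk+m}}{L_j^k}B_{n-k}=\begin{cases}F_mB_n\big(\frac{\alpha^j}{L_j}\big)+\frac{nF_{j(n-1)+m}}{L_j^{n-1}}, & n\text{ even},\\[4pt] -\frac{L_m}{\sqrt5}B_n\big(\frac{\alpha^j}{L_j}\big)-\frac{nF_{j(n-1)+m}}{L_j^{n-1}}, & n\text{ odd},\end{cases} \] \[ \sum_{k=0}^n(-1)^k\binom{n}{k}\frac{L_{jk+m}}{L_j^k}B_{n-k}=\begin{cases}L_mB_n\big(\frac{\alpha^j}{L_j}\big)+\frac{nL_{j(n-1)+m}}{L_j^{n-1}}, & n\text{ even},\\[4pt] -\sqrt5F_mB_n\big(\frac{\alpha^j}{L_j}\big)-\frac{nL_{j(n-1)+m}}{L_j^{n-1}}, & n\text{ odd}.\end{cases} \]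
   Context: $\alpha=\frac{1+\sqrt5}{2}$, $\beta=\frac{1-\sqrt5}{2}$. For every integer $s$, $F_s=\frac{\alpha^s-\beta^s}{\sqrt5}$ and $L_s=\alpha^s+\beta^s$ (Fibonacci and Lucas numbers extended to all integers). The Bernoulli polynomials $B_n(x)$ are defined by $\sum_{n\ge0}B_n(x)\frac{z^n}{n!}=\frac{ze^{xz}}{e^z-1}$, and $B_n=B_n(0)$. For $n=0$ the terms $nF_{j(n-1)+m}/L_j^{n-1}$ and $nL_{j(n-1)+m}/L_j^{n-1}$ are $0$. *)

(* Defs.v *)
From HB Require Import structures.
From mathcomp Require Import all_boot all_order all_algebra.
From mathcomp Require Import reals.

Set Implicit Arguments.
Unset Strict Implicit.
Unset Printing Implicit Defensive.

Import Order.TTheory GRing.Theory Num.Theory.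
Local Open Scope ring_scope.

(* A formal power series \sum_n f_n z^n is its coefficient sequence [f]. *)
Section FormalPowerSeries.
Variable A : comUnitRingType.
Implicit Types f g : nat -> A.

Definition fps_mul f g : nat -> A :=
  fun n => \sum_(i < n.+1) f i * g (n - i)%N.

Definition fps_var : nat -> A := fun n => (n == 1)%:R.

(* exp (a z) *)
Definition fps_exp (a : A) : nat -> A := fun n => a ^+ n / n`!%:R.

(* The first [n] coefficients of f / g, by long division; it is meaningful
   when [g 0] is a unit, see [fps_divK]. *)
Fixpoint fps_div_seq f g (n : nat) : seq A :=
  if n is k.+1 then
    let s := fps_div_seq f g k in
    rcons s ((f k - \sum_(i < k) s`_i * g (k - i)%N) / g 0)
  else [::].

Definition fps_div f g : nat -> A := fun n => (fps_div_seq f g n.+1)`_n.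

Lemma size_fps_div_seq f g n : size (fps_div_seq f g n) = n.
Proof. by elim: n => //= n IHn; rewrite size_rcons IHn. Qed.

Lemma nth_fps_div_seq f g n i :
  (i < n)%N -> (fps_div_seq f g n)`_i = fps_div f g i.
Proof.
elim: n => // n IHn; rewrite ltnS leq_eqVlt => /predU1P[-> // | lt_in].
by rewrite /= nth_rcons size_fps_div_seq lt_in IHn.
Qed.

Lemma fps_divE f g n :
  fps_div f g n = (f n - \sum_(i < n) fps_div f g i * g (n - i)%N) / g 0.
Proof.
rewrite /fps_div /= nth_rcons size_fps_div_seq ltnn eqxx.
congr ((_ - _) / _); apply: eq_bigr => i _.
by rewrite nth_fps_div_seq.
Qed.

Lemma fps_divK f g : g 0 \is a GRing.unit -> fps_mul (fps_div f g) g =1 f.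
Proof.
move=> Ug n; rewrite /fps_mul big_ord_recr /= subnn [fps_div f g n]fps_divE.
by rewrite divrK // addrC subrK.
Qed.

End FormalPowerSeries.

Section Bernoulli.
Variable K : numFieldType.

(* B_n(x) is n! times the coefficient of z^n in z e^(xz) / (e^z - 1), a power
   series over K[x].  As e^z - 1 has no constant term, z is cancelled first:
   the divisor below is (e^z - 1) / z. *)
Definition bernoulli_poly (n : nat) : {poly K} :=
  n`!%:R * fps_div (fps_exp 'X) (fun i => fps_exp 1 i.+1) n.

Definition bernoulli (n : nat) : K := (bernoulli_poly n).[0].

Lemma bernoulli_poly_gf :
  fps_mul (fun n => bernoulli_poly n / n`!%:R)
          (fun n => fps_exp 1 n - (n == 0)%:R)
  =1 fps_mul (@fps_var {poly K}) (fps_exp 'X).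
Proof.
have Uf n : (n`!%:R : {poly K}) \is a GRing.unit.
  by rewrite -polyC_natr rmorph_unit // unitfE pnatr_eq0 -lt0n fact_gt0.
have U1 : fps_exp (1 : {poly K}) 1 \is a GRing.unit.
  by rewrite /fps_exp expr1n div1r unitrV.
have e0 : fps_exp (1 : {poly K}) 0 - 1 = 0 by rewrite /fps_exp expr0 divr1 subrr.
case=> [|n]; first by rewrite /fps_mul !big_ord1 /= e0 mulr0 mul0r.
rewrite {1}/fps_mul big_ord_recr /= subnn eqxx e0 mulr0 addr0.
transitivity (fps_exp ('X : {poly K}) n).
  rewrite -[RHS](fps_divK (fps_exp 'X) (g := fun i => fps_exp 1 i.+1) U1 n).
  apply: eq_bigr => i _.
  have le_in : (i <= n)%N by rewrite -ltnS.
  by rewrite /bernoulli_poly [_ / _]mulrC mulKr // subSn //= subr0.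
rewrite /fps_mul big_ord_recl /= /fps_var mul0r add0r big_ord_recl /= mul1r.
rewrite subn1 /= big1 ?addr0 // => i _.
by rewrite mul0r.
Qed.

End Bernoulli.

Section FibonacciLucas.
Variable R : rcfType.

Definition sqrt5 : R := Num.sqrt 5.
Definition alpha : R := (1 + sqrt5) / 2.
Definition beta : R := (1 - sqrt5) / 2.

Definition fib (s : int) : R := (alpha ^ s - beta ^ s) / sqrt5.
Definition lucas (s : int) : R := alpha ^ s + beta ^ s.

End FibonacciLucas.
Arguments sqrt5 {R}.
Arguments alpha {R}.
Arguments beta {R}.
Arguments fib {R} s.
Arguments lucas {R} s.
Arguments bernoulli {K} n.
Arguments bernoulli_poly {K} n.

(* Main.v *)
(* Put x = alpha^j / L_j and y = beta^j / L_j, so that x + y = 1.  Splitting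
   F and L into powers of alpha and beta turns the left-hand sides into
   combinations of B_n(-x) and B_n(-y), because
   B_n(a) = \sum_k C(n, k) a^k B_(n-k).  The relations
   B_n(a + 1) = B_n(a) + n a^(n-1) and B_n(1 - a) = (-1)^n B_n(a) give
   B_n(-a) = (-1)^n (B_n(a) + n a^(n-1)), and then B_n(y) = (-1)^n B_n(x). *)
Require Import Defs.
From HB Require Import structures.
From mathcomp Require Import all_boot all_order all_algebra.
From mathcomp Require Import reals ring lra.

Set Implicit Arguments.
Unset Strict Implicit.
Unset Printing Implicit Defensive.

Import Order.TTheory GRing.Theory Num.Theory.
Local Open Scope ring_scope.

Section BernoulliPolynomials.
Variable K : numFieldType.
Implicit Types a h : K.

Local Notation B := (@bernoulli_poly K).

Lemma natr_poly_unit n : (n.+1%:R : {poly K}) \is a GRing.unit.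
Proof. by rewrite -polyC_natr rmorph_unit // unitfE pnatr_eq0. Qed.

Lemma fact_poly_unit n : (n`!%:R : {poly K}) \is a GRing.unit.
Proof. by case: (n`!) (fact_gt0 n) => // k _; apply: natr_poly_unit. Qed.

(** Compare coefficients of z^n in (sum of B_k z^k / k!) * ((e^z - 1) / z) = e^(Xz), then multiply
    by (n+1)!. *)
Lemma bernoulli_poly_rec n :
  \sum_(k < n.+1) 'C(n.+1, k)%:R * B k = n.+1%:R * 'X^n.
Proof.
have U1 : fps_exp (1 : {poly K}) 1 \is a GRing.unit.
  by rewrite /fps_exp expr1n div1r unitrV fact_poly_unit.
have := fps_divK (fps_exp 'X) (g := fun i => fps_exp 1 i.+1) U1 n.
move/(congr1 (fun p => n.+1`!%:R * p)); rewrite /fps_mul mulr_sumr => E.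
transitivity ((n.+1)`!%:R * fps_exp 'X n : {poly K}); last first.
  rewrite /fps_exp factS natrM -mulrA; congr (_ * _).
  by rewrite mulrCA mulrV ?mulr1 ?fact_poly_unit.
rewrite -E; apply: eq_bigr => i _; rewrite /bernoulli_poly.
have lein : (i <= n)%N by rewrite -ltnS.
rewrite -(bin_fact (leqW lein)) !natrM /fps_exp expr1n -subSn //.
set d := fps_div _ _ _; set c := (_ - _)`!%:R.
have cV : c * c^-1 = 1 by rewrite mulrV ?fact_poly_unit.
by rewrite div1r -!mulrA; congr (_ * (_ * _)); rewrite mulrCA cV mulr1.
Qed.

Lemma bernoulli_poly0 : B 0 = 1.
Proof. by have := bernoulli_poly_rec 0; rewrite big_ord1 !mul1r. Qed.

(** Differentiate the recurrence at n+1. By induction and k C(n+2, k) = (n+2) C(n+1, k-1), the lower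
    terms match n+2 times the recurrence at n, so only the top terms are left to compare. *)
Lemma deriv_bernoulli_poly n : (B n)^`() = n%:R * B n.-1.
Proof.
elim/ltn_ind: n => -[|n] IH.
  by rewrite bernoulli_poly0 mul0r derivC.
have := congr1 (@deriv K) (bernoulli_poly_rec n.+1).
have dN (k : nat) (p : {poly K}) : (k%:R * p)^`() = k%:R * p^`().
  by rewrite !mulr_natl derivMn.
rewrite dN derivXn big_ord_recr /= derivD dN (raddf_sum (@deriv K)).
rewrite big_ord_recl /= dN bernoulli_poly0 derivC mulr0 add0r.
have -> : \sum_(i < n) ('C(n.+2, bump 0 i)%:R * B (bump 0 i))^`()
   = n.+2%:R * \sum_(i < n) 'C(n.+1, i)%:R * B i.
  rewrite mulr_sumr; apply: eq_bigr => i _.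
  rewrite -[bump 0 i]/(i.+1) dN IH ?ltnS // [LHS]mulrA [RHS]mulrA -!natrM.
  by rewrite mulnC -(mul_bin_diag n.+2).
rewrite -(mulr_natl 'X^n) -bernoulli_poly_rec big_ord_recr /= !binSn.
rewrite mulrDr => /addrI.
by move/(mulrI (natr_poly_unit n.+1)).
Qed.

Lemma nderivn_bernoulli_poly n i :
  (B n)^`N(i) = 'C(n, i)%:R * B (n - i)%N.
Proof.
apply: (mulIr (fact_poly_unit i)).
rewrite mulr_natr -nderivn_def mulrAC -natrM bin_ffact.
elim: i => [|i IH]; first by rewrite derivn0 ffactn0 mul1r subn0.
rewrite derivnS IH mulr_natl derivMn deriv_bernoulli_poly ffactnSr.
by rewrite -[LHS]mulr_natl natrM subnS [LHS]mulrA.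
Qed.

Lemma bernoulli_poly_add n a h :
  (B n).[a + h] = \sum_(k < n.+1) 'C(n, k)%:R * h ^+ k * (B (n - k)).[a].
Proof.
(* Taylor expansion at a. Both sums are widened to a common range; the terms with k > n vanish
   because C(n, k) = 0. *)
rewrite (nderiv_taylor_wide (mulrC a h) (leq_maxl (size (B n)) n.+1)).
rewrite (big_ord_widen _ (fun k => 'C(n, k)%:R * h ^+ k * (B (n - k)).[a])
          (leq_maxr (size (B n)) n.+1)) [RHS]big_mkcond.
apply: eq_bigr => i _; rewrite nderivn_bernoulli_poly ltnS.
rewrite mulr_natl hornerMn -mulr_natl mulrAC.
by case: leqP => // /bin_small->; rewrite !mul0r.
Qed.

Lemma bernoulli_poly_sum n a :
  \sum_(k < n.+1) 'C(n, k)%:R * a ^+ k * bernoulli (n - k) = (B n).[a].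
Proof. by rewrite -[in RHS](add0r a) bernoulli_poly_add; apply: eq_bigr. Qed.

Lemma bernoulli_poly_succ n a :
  (B n).[a + 1] = (B n).[a] + n%:R * a ^+ n.-1.
Proof.
case: n => [|n].
  by rewrite bernoulli_poly0 !hornerC mul0r addr0.
have := congr1 (horner^~ a) (bernoulli_poly_rec n).
rewrite horner_sum mulr_natl hornerMn hornerXn -mulr_natl => <-.
(* With h = 1, what remains after the k = 0 term is the recurrence summed in reverse order. *)
rewrite bernoulli_poly_add big_ord_recl bin0 expr0 !mul1r subn0; congr (_ + _).
rewrite (reindex_inj rev_ord_inj); apply: eq_bigr => i _.
have lein : (i <= n)%N by rewrite -ltnS.
rewrite expr1n mulr1 /= /bump leq0n add1n !subSS subKn //.
rewrite -subSn // bin_sub ?leqW //.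
by rewrite [in RHS]mulr_natl hornerMn -[RHS]mulr_natl.
Qed.

(* The numbers (-1)^n B_n(1 - a) satisfy the recurrence [bernoulli_poly_rec]
   evaluated at a, which determines the B_n(a). *)
Lemma bernoulli_poly_refl n a : (B n).[1 - a] = (-1) ^+ n * (B n).[a].
Proof.
elim/ltn_ind: n => n IH.
have rec c : \sum_(k < n.+1) 'C(n.+1, k)%:R * (B k).[c] = n.+1%:R * c ^+ n.
  have := congr1 (horner^~ c) (bernoulli_poly_rec n).
  rewrite horner_sum mulr_natl hornerMn hornerXn -mulr_natl => <-.
  by apply: eq_bigr => i _; rewrite !mulr_natl hornerMn.
have alt : \sum_(k < n.+1) 'C(n.+1, k)%:R * ((-1) ^+ k * (B k).[1 - a])
    = n.+1%:R * a ^+ n.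
  (* Expand B_(n+1)(-a) around 1 - a. Since B_(n+1)(1 - a) = B_(n+1)(-a) + (n+1)(-a)^n, the terms
     B_(n+1)(-a) cancel. *)
  have := bernoulli_poly_add n.+1 (1 - a) (-1).
  rewrite addrAC subrr add0r big_ord_recl bin0 expr0 !mul1r subn0.
  have := bernoulli_poly_succ n.+1 (- a); rewrite [- a + 1]addrC => -> /=.
  rewrite -addrA => /eqP; rewrite eq_sym -subr_eq0 addrAC subrr add0r.
  rewrite addrC addr_eq0 => /eqP.
  rewrite (reindex_inj rev_ord_inj) => /(congr1 (fun x => (-1) ^+ n.+1 * x)).
  rewrite mulr_sumr (exprNn a) => E.
  transitivity ((-1) ^+ n.+1 * - (n.+1%:R * ((-1) ^+ n * a ^+ n))); last first.
    by rewrite exprS mulN1r mulrNN mulrCA signrMK.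
  rewrite -E; apply: eq_bigr => i _.
  have lein : (i <= n)%N by rewrite -ltnS.
  rewrite /= /bump leq0n add1n !subSS subKn // -subSn // bin_sub ?leqW //.
  have <- : (-1) ^+ n.+1 * (-1) ^+ (n.+1 - i) = (-1) ^+ i :> K.
    by rewrite -exprD -signr_odd oddD oddB ?leqW // addKb signr_odd.
  by rewrite -!mulrA [RHS]mulrCA.
have := etrans alt (esym (rec a)).
rewrite !big_ord_recr /=.
have -> : \sum_(i < n) 'C(n.+1, i)%:R * ((-1) ^+ i * (B i).[1 - a])
  = \sum_(i < n) 'C(n.+1, i)%:R * (B i).[a].
  by apply: eq_bigr => i _; rewrite IH // signrMK.
move/addrI; rewrite binSn => /(mulfI _) <-; last by rewrite pnatr_eq0.
by rewrite signrMK.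
Qed.

Lemma bernoulli_polyN n a :
  (B n).[- a] = (-1) ^+ n * ((B n).[a] + n%:R * a ^+ n.-1).
Proof.
by rewrite -bernoulli_poly_succ -bernoulli_poly_refl opprD addrCA subrr addr0.
Qed.

End BernoulliPolynomials.

(** Common form of the alpha and beta halves: the powers (-t^j / l)^k turn the sum into t^m B_n(-t^j
    / l). *)
Lemma bernoulli_poly_geometric (K : numFieldType) (t l : K) (j m : int) n :
  t != 0 ->
  \sum_(k < n.+1) (-1) ^+ k * 'C(n, k)%:R * (t ^ (j * k%:Z + m) / l ^+ k)
      * bernoulli (n - k)
  = (-1) ^+ n * (t ^ m * (bernoulli_poly n).[t ^ j / l]
                 + n%:R * t ^ (j * (n%:Z - 1) + m) / l ^ (n%:Z - 1)).
Proof.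
move=> t0; transitivity (t ^ m * (bernoulli_poly n).[- (t ^ j / l)]).
  rewrite -bernoulli_poly_sum mulr_sumr; apply: eq_bigr => k _.
  rewrite expfzDr // -exprz_exp -exprnP (exprNn (_ / _)) expr_div_n.
  by rewrite !mulrA; congr (_ * _); ring.
rewrite bernoulli_polyN mulrCA mulrDr; congr (_ * (_ + _)).
(* At n = 0 the exponents [n.-1] = 0 and [n%:Z - 1] = -1 disagree, but the factor n kills both
   terms. *)
case: n => [|n]; first by rewrite !mul0r mulr0.
rewrite -addn1 PoszD addrK addn1 /= expfzDr // -exprz_exp -!exprnP expr_div_n.
by rewrite mulrCA -!mulrA; congr (_ * _); ring.
Qed.

Section FibonacciLucas.
Variable R : rcfType.

Local Notation alpha := (@alpha R).
Local Notation beta := (@beta R).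
Local Notation sqrt5 := (@sqrt5 R).

Lemma sqrt5_gt1 : 1 < sqrt5.
Proof. by rewrite -{1}[1]sqrtr1 ltr_sqrt ?ltr1n ?ltr0n. Qed.

Lemma beta_lt0 : beta < 0.
Proof. by rewrite /beta; have := sqrt5_gt1; lra. Qed.

Lemma normr_beta_lt_alpha : `|beta| < alpha.
Proof. by rewrite ltr0_norm ?beta_lt0 // /alpha /beta; lra. Qed.

(** For a positive exponent, alpha^n = - beta^n would force |alpha| = |beta|. Negative exponents
    reduce to this case by taking out 1 / (alpha beta)^n. *)
Lemma lucas_neq0 j : lucas j != 0 :> R.
Proof.
have nat_neq0 n : alpha ^+ n + beta ^+ n != 0.
  case: n => [|n]; first by rewrite !expr0 -mulr2n pnatr_eq0.
  rewrite addr_eq0; apply: contraTneq isT => /(congr1 Num.norm).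
  rewrite normrN !normrX => /eqP; rewrite eqrXn2 // => /eqP E.
  by have := normr_beta_lt_alpha; rewrite -E ltNge ler_norm.
have a0 : alpha != 0.
  by rewrite gt_eqF // (le_lt_trans _ normr_beta_lt_alpha).
have b0 : beta != 0 by rewrite lt_eqF ?beta_lt0.
case: j => n; first exact: nat_neq0.
rewrite /lucas !NegzE -!exprnN.
have -> : alpha ^- n.+1 + beta ^- n.+1
    = (alpha ^+ n.+1 + beta ^+ n.+1) / (alpha ^+ n.+1 * beta ^+ n.+1).
  by field; rewrite !expf_neq0.
by rewrite mulf_neq0 // invr_eq0 mulf_neq0 ?expf_neq0.
Qed.

Lemma bernoulli_poly_beta n (j : int) :
  (bernoulli_poly n).[beta ^ j / lucas j]
    = (-1) ^+ n * (bernoulli_poly n).[alpha ^ j / lucas j].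
Proof.
rewrite -bernoulli_poly_refl; congr _.[_].
apply: (mulIf (lucas_neq0 j)).
by rewrite mulrBl !divfK ?lucas_neq0 // mul1r /lucas addrC addKr.
Qed.

End FibonacciLucas.

Theorem theorem15 (R : realType) (j m : int) (n : nat) :
  (\sum_(k < n.+1)
      (-1) ^+ k * 'C(n, k)%:R * (fib (j * k%:Z + m) / lucas j ^+ k)
        * bernoulli (n - k) : R)
    = (if ~~ odd n
       then fib m * (bernoulli_poly n).[alpha ^ j / lucas j]
            + n%:R * fib (j * (n%:Z - 1) + m) / lucas j ^ (n%:Z - 1)
       else - (lucas m / sqrt5) * (bernoulli_poly n).[alpha ^ j / lucas j]
            - n%:R * fib (j * (n%:Z - 1) + m) / lucas j ^ (n%:Z - 1))
  /\
  (\sum_(k < n.+1)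
      (-1) ^+ k * 'C(n, k)%:R * (lucas (j * k%:Z + m) / lucas j ^+ k)
        * bernoulli (n - k) : R)
    = (if ~~ odd n
       then lucas m * (bernoulli_poly n).[alpha ^ j / lucas j]
            + n%:R * lucas (j * (n%:Z - 1) + m) / lucas j ^ (n%:Z - 1)
       else - (sqrt5 * fib m) * (bernoulli_poly n).[alpha ^ j / lucas j]
            - n%:R * lucas (j * (n%:Z - 1) + m) / lucas j ^ (n%:Z - 1)).
Proof.
have a0 : alpha != 0 :> R.
  by rewrite gt_eqF // (le_lt_trans _ (normr_beta_lt_alpha R)).
have b0 : beta != 0 :> R by rewrite lt_eqF ?beta_lt0.
have s0 : sqrt5 != 0 :> R by rewrite gt_eqF // (lt_trans _ (sqrt5_gt1 R)).
have A := bernoulli_poly_geometric (lucas j) j m n a0.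
have := bernoulli_poly_geometric (lucas j) j m n b0.
rewrite bernoulli_poly_beta => Bt.
split.
  transitivity (((\sum_(k < n.+1) (-1) ^+ k * 'C(n, k)%:R *
      (alpha ^ (j * k%:Z + m) / lucas j ^+ k) * bernoulli (n - k)) -
    (\sum_(k < n.+1) (-1) ^+ k * 'C(n, k)%:R *
      (beta ^ (j * k%:Z + m) / lucas j ^+ k) * bernoulli (n - k))) / sqrt5 : R).
    by rewrite -sumrB mulr_suml; apply: eq_bigr => k _; rewrite /fib; ring.
  (* The extra sign (-1)^n in [Bt] explains the two cases: for odd n it turns alpha^m - beta^m into
     alpha^m + beta^m, hence F_m into L_m / sqrt5. *)
  rewrite A Bt -signr_odd; set l := lucas j ^ _; rewrite /fib /lucas.
  by case: (odd n); rewrite /= ?expr0 ?expr1; ring.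
transitivity ((\sum_(k < n.+1) (-1) ^+ k * 'C(n, k)%:R *
    (alpha ^ (j * k%:Z + m) / lucas j ^+ k) * bernoulli (n - k)) +
  (\sum_(k < n.+1) (-1) ^+ k * 'C(n, k)%:R *
    (beta ^ (j * k%:Z + m) / lucas j ^+ k) * bernoulli (n - k)) : R).
  rewrite -big_split; apply: eq_bigr => k _; rewrite /lucas /=.
  by set l := (_ + _) ^+ k; ring.
have sF : sqrt5 * fib m = alpha ^ m - beta ^ m :> R by rewrite mulrC divfK.
rewrite A Bt sF -signr_odd; set l := lucas j ^ _; set x := _ / lucas j.
by rewrite /lucas; case: (odd n); rewrite /= ?expr0 ?expr1; ring.
Qed.
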